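(* Let $K$ be an algebraically closed field of characteristic $0$, let $H=(V,\mu,\eta,\Delta,\varepsilon,S)$ be a finite-dimensional Hopf algebra over $K$, and let $f_t=\varphi+t\cdot id$ be a family of linear maps of $V$, where $\varphi:V\to V$ is a singular linear map, with associated decomposition $V=V_R\oplus V_N$. Then the degeneration $H_0=\lim_{t\to0}f_t\cdot H$ exists if and only if the following two conditions hold. (i) For all $x,y\in V$, $$\varphi^2\left(\mu(x\otimes y)_N\right)-\varphi\left(\mu(\varphi(x)\otimes y)_N\right)-\varphi\left(\mu(x\otimes\varphi(y))_N\right)+\mu(\varphi(x)\otimes\varphi(y))_N=0.$$ (ii) For all $x\in V$, $$\begin{array}{l} x_R^{(1)}\otimes\varphi(x_N^{(2)})-\varphi(x)_R^{(1)}\otimes\varphi(x)_N^{(2)}=0,\\ \varphi(x_N^{(1)})\otimes x_R^{(2)}-\varphi(x)_N^{(1)}\otimes\varphi(x)_R^{(2)}=0,\\ x_N^{(1)}\otimes x_N^{(2)}=0,\\ \varphi(x)_N^{(1)}\otimes\varphi(x)_N^{(2)}-x_N^{(1)}\otimes\varphi(x_N^{(2)})=0.\end{array}$$ In that case the antipode remains for $H_0$, and the multiplication and comultiplication defined by $$\mu_0(x\otimes y)=\varphi^{-1}\left(\mu(\varphi(x)\otimes\varphi(y))_R\right)+\mu(\varphi(x)\otimes y)_N+\mu(x\otimes\varphi(y))_N-\varphi\left(\mu(x\otimes y)_N\right),$$ $$\Delta_0(x)=\varphi^{-1}(\varphi(x)_R^{(1)})\otimes\varphi^{-1}(\varphi(x)_R^{(2)})+\varphi^{-1}(x_R^{(1)})\otimes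 x_N^{(2)}+x_N^{(1)}\otimes\varphi^{-1}(x_R^{(2)})$$ satisfy $(\mu_0\otimes\mu_0)\circ(id\otimes\tau\otimes id)\circ(\Delta_0\otimes\Delta_0)=\Delta_0\circ\mu_0$, where $\tau$ is the twist map, and $\mu_0\circ(S\otimes id)\circ\Delta_0=\mu_0\circ(id\otimes S)\circ\Delta_0=\eta\circ\varepsilon$.
   Context: Fitting decomposition: $V=V_R\oplus V_N$ with $V_R,V_N$ the canonical $\varphi$-invariant subspaces such that $\varphi$ is surjective (hence bijective) on $V_R$ and nilpotent on $V_N$. For $v\in V$ write $v=v_R+v_N$ with $v_R\in V_R$, $v_N\in V_N$. On $V_R$, $\varphi^{-1}$ denotes the inverse of $\varphi|_{V_R}$. Sweedler-type notation (summation understood): $\Delta(x)=x^{(1)}\otimes x^{(2)}$, $\Delta(\varphi(x))=\varphi(x)^{(1)}\otimes\varphi(x)^{(2)}$, with $x^{(i)}=x_R^{(i)}+x_N^{(i)}$ and $\varphi(x)^{(i)}=\varphi(x)_R^{(i)}+\varphi(x)_N^{(i)}$ for $i=1,2$; e.g. $x_R^{(1)}\otimes x_N^{(2)}$ is the component of $\Delta(x)$ in $V_R\otimes V_N$, and $\varphi(x)_N^{(1)}\otimes\varphi(x)_N^{(2)}$ is the component of $\Delta(\varphi(x))$ in $V_N\otimes V_N$. For $t\neq0$ near $0$, $f_t$ is invertible and acts by $f_t\cdot\mu=f_t^{-1}\circ\mu\circ(f_t\otimes f_t)$, $f_t\cdot\Delta=(f_t^{-1}\otimes f_t^{-1})\circ\Delta\circ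 f_t$, $f_t\cdot\varepsilon=\varepsilon\circ f_t$. The structure constants of $f_t\cdot\mu$ and $f_t\cdot\Delta$ are rational functions of $t$; the limit as $t\to0$ exists when all of them are regular at $t=0$, and is given by their values there: $\mu_0=\lim_{t\to0}f_t\cdot\mu$ and $\Delta_0=\lim_{t\to0}f_t\cdot\Delta$ are the multiplication and comultiplication of $H_0$.
   Formalization: In the last identity, η, ε and S are the unit, counit and antipode of H_0, i.e. the limits of f_t^{-1}∘η, ε∘f_t and f_t^{-1}∘S∘f_t (proved to exist); with the original η, ε, S of H the identity can fail, e.g. Sweedler's H_4 with φ(1)=1, φ(g)=2g, φ(x)=φ(gx)=0. *)

(* Defs.v *)
From HB Require Import structures.
From mathcomp Require Import all_boot all_order all_algebra.

Set Implicit Arguments.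
Unset Strict Implicit.
Unset Printing Implicit Defensive.

Import GRing.Theory.
Local Open Scope ring_scope.

Reserved Notation "v ⊗ w" (at level 40, left associativity).
Reserved Notation "f ⊠ g" (at level 40, left associativity).

(* V ⊗ W is represented by matrices of coordinates in the bases vbasis {:V} and *)
(* vbasis {:W}; tlift, tliftE and tensP give the universal property, and every  *)
(* other map out of a tensor product is defined through tlift only.             *)
Definition tens (K : fieldType) (V W : vectType K) : Type :=
  'M[K]_(\dim {:V}, \dim {:W}).

HB.instance Definition _ (K : fieldType) (V W : vectType K) :=
  Vector.on (tens V W).

Definition tpure (K : fieldType) (V W : vectType K) (v : V) (w : W) :
  tens V W :=
  \matrix_(i, j) (coord (vbasis {:V}) i v * coord (vbasis {:W}) j w).

Notation "v ⊗ w" := (tpure v w) : ring_scope.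

Definition tlift_fun (K : fieldType) (V W U : vectType K) (b : V -> W -> U)
    (T : tens V W) : U :=
  \sum_i \sum_j (T : 'M[K]_(\dim {:V}, \dim {:W})) i j
     *: b (vbasis {:V})`_i (vbasis {:W})`_j.

(* For bilinear b, the linear map sending v ⊗ w to b v w.                      *)
Definition tlift (K : fieldType) (V W U : vectType K) (b : V -> W -> U) :
  'Hom(tens V W, U) := linfun (tlift_fun b).

Section TensorTheory.
Variables (K : fieldType) (V W U : vectType K).

Lemma tlift_fun_linear (b : V -> W -> U) : linear (tlift_fun b).
Proof.
move=> a T T'; rewrite /tlift_fun scaler_sumr -big_split /=.
apply: eq_bigr => i _; rewrite scaler_sumr -big_split /=.
by apply: eq_bigr => j _; rewrite !mxE scalerDl scalerA.
Qed.

Lemma tliftT (b : V -> W -> U) T : tlift b T = tlift_fun b T.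
Proof.
pose f := GRing.isLinear.Build _ _ _ _ (tlift_fun b) (tlift_fun_linear b).
pose g : {linear tens V W -> U} := HB.pack (tlift_fun b) f.
exact: (lfunE g T).
Qed.

Lemma tliftE (b : V -> W -> U) (v : V) (w : W) :
  (forall w', linear (b^~ w')) -> (forall v', linear (b v')) ->
  tlift b (v ⊗ w) = b v w.
Proof.
move=> bl br.
pose gl w' : {linear V -> U} :=
  HB.pack (b^~ w') (GRing.isLinear.Build _ _ _ _ (b^~ w') (bl w')).
pose gr v' : {linear W -> U} :=
  HB.pack (b v') (GRing.isLinear.Build _ _ _ _ (b v') (br v')).
have dec (X : vectType K) (x : X) :
    x = \sum_i coord (vbasis {:X}) i x *: (vbasis {:X})`_i.
  exact: coord_vbasis (memvf x).
rewrite tliftT /tlift_fun {2}[v]dec -[b _ w]/(gl w _) linear_sum /=.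
apply: eq_bigr => i _; rewrite -[b _ w]/(gl w _) linearZ /=.
rewrite {2}[w]dec -[b _ _ in RHS]/(gr _ _) linear_sum scaler_sumr.
by apply: eq_bigr => j _; rewrite linearZ /= scalerA mxE.
Qed.

Lemma tensP (f g : 'Hom(tens V W, U)) :
  (forall v w, f (v ⊗ w) = g (v ⊗ w)) -> f = g.
Proof.
move=> fg; apply/lfunP=> T.
have -> : T = \sum_i \sum_j (T : 'M[K]_(\dim {:V}, \dim {:W})) i j
     *: ((vbasis {:V})`_i ⊗ (vbasis {:W})`_j) :> tens V W.
  rewrite [LHS]matrix_sum_delta.
  apply: eq_bigr => i _; apply: eq_bigr => j _; congr (_ *: _).
  apply/matrixP=> i' j'; rewrite !mxE !coord_free ?(basis_free (vbasisP _)) //.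
  by rewrite -!val_eqE /= [i' == i :> nat]eq_sym [j' == j :> nat]eq_sym -natrM mulnb.
rewrite !linear_sum; apply: eq_bigr => i _.
by rewrite !linear_sum; apply: eq_bigr => j _; rewrite !linearZ /= fg.
Qed.

End TensorTheory.

Definition tmap (K : fieldType) (V W V' W' : vectType K)
    (f : 'Hom(V, V')) (g : 'Hom(W, W')) : 'Hom(tens V W, tens V' W') :=
  tlift (fun v w => f v ⊗ g w).

Notation "f ⊠ g" := (tmap f g) : ring_scope.

Definition tassoc (K : fieldType) (V : vectType K) :
    'Hom(tens (tens V V) V, tens V (tens V V)) :=
  tlift (fun s z => tlift (fun x y => x ⊗ (y ⊗ z)) s).

(* id ⊗ twist ⊗ id on V ⊗ V ⊗ V ⊗ V, bracketed as (V ⊗ V) ⊗ (V ⊗ V).           *)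
Definition tmid (K : fieldType) (V : vectType K) :
    'End(tens (tens V V) (tens V V)) :=
  tlift (fun s s' =>
    tlift (fun a b => tlift (fun c d => (a ⊗ c) ⊗ (b ⊗ d)) s') s).

Section TensorMaps.
Variables (K : fieldType).

Lemma tpure_linearl (V W : vectType K) (w : W) :
  linear (fun v : V => v ⊗ w).
Proof.
by move=> a v v'; apply/matrixP=> i j; rewrite !mxE linearP mulrDl mulrA.
Qed.

Lemma tpure_linearr (V W : vectType K) (v : V) :
  linear (fun w : W => v ⊗ w).
Proof.
by move=> a w w'; apply/matrixP=> i j; rewrite !mxE linearP mulrDr mulrCA.
Qed.

Lemma tmapE (V W V' W' : vectType K) (f : 'Hom(V, V')) (g : 'Hom(W, W')) v w :
  (f ⊠ g) (v ⊗ w) = f v ⊗ g w.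
Proof.
rewrite /tmap tliftE // => u a x y; rewrite linearP /=.
- exact: (tpure_linearl (g u)).
- exact: (tpure_linearr (f u)).
Qed.

End TensorMaps.

Record is_hopf (K : fieldType) (V : vectType K)
    (mu : 'Hom(tens V V, V)) (eta : 'Hom(K^o, V))
    (Delta : 'Hom(V, tens V V)) (eps : 'Hom(V, K^o)) (S : 'End(V)) : Prop :=
  IsHopf {
    hopf_mulA : forall x y z, mu (mu (x ⊗ y) ⊗ z) = mu (x ⊗ mu (y ⊗ z));
    hopf_mul1l : forall x, mu (eta 1 ⊗ x) = x;
    hopf_mul1r : forall x, mu (x ⊗ eta 1) = x;
    hopf_coassoc : (tassoc V \o (Delta ⊠ \1) \o Delta)%VF
                   = ((\1 ⊠ Delta) \o Delta)%VF;
    hopf_counitl : forall x, tlift (fun v w => eps v *: w) (Delta x) = x;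
    hopf_counitr : forall x, tlift (fun v w => eps w *: v) (Delta x) = x;
    hopf_comulM :
      ((mu ⊠ mu) \o tmid V \o (Delta ⊠ Delta))%VF = (Delta \o mu)%VF;
    hopf_comul1 : Delta (eta 1) = eta 1 ⊗ eta 1;
    hopf_counitM : forall x y, eps (mu (x ⊗ y)) = eps x * eps y;
    hopf_counit1 : eps (eta 1) = 1;
    hopf_antipodel : (mu \o (S ⊠ \1) \o Delta)%VF = (eta \o eps)%VF;
    hopf_antipoder : (mu \o (\1 ⊠ S) \o Delta)%VF = (eta \o eps)%VF
  }.

Record is_fitting (K : fieldType) (V : vectType K) (phi : 'End(V))
    (VR VN : {vspace V}) : Prop := IsFitting {
  fitting_add : (VR + VN)%VS = fullv;
  fitting_cap : (VR :&: VN)%VS = 0%VS;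
  fitting_surj : (phi @: VR)%VS = VR;
  fitting_stab : (phi @: VN <= VN)%VS;
  fitting_nil : exists m : nat, forall v, v \in VN -> iter m phi v = 0
}.

(* The inverse of the restriction of phi to VR (see fitting_invP); it is only  *)
(* meaningful on VR.  Note that phi^-1 is a right inverse of phi on its image, *)
(* but need not take its values in VR.                                         *)
Definition fitting_inv (K : fieldType) (V : vectType K) (phi : 'End(V))
    (VR VN : {vspace V}) : 'End(V) := (daddv_pi VR VN \o phi^-1)%VF.

Lemma fitting_invP (K : fieldType) (V : vectType K) (phi : 'End(V))
    (VR VN : {vspace V}) : is_fitting phi VR VN ->
  forall v, v \in VR ->
    fitting_inv phi VR VN v \in VR /\ phi (fitting_inv phi VR VN v) = v.
Proof.
case=> VRN VRN0 phiR phiN _ v vR; rewrite /fitting_inv comp_lfunE.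
split; first exact: memv_pi.
set u := (phi^-1)%VF v; have phiu : phi u = v.
  by apply: limg_lfunVK; rewrite (subvP (limgS phi (subvf VR))) ?phiR.
have := @daddv_pi_add _ _ VR VN u VRN0; rewrite VRN memvf => /(_ isT) eu.
have pRR : phi (daddv_pi VR VN u) \in VR by rewrite -{2}phiR memv_img ?memv_pi.
have pNN : phi (daddv_pi VN VR u) \in VN.
  by apply: (subvP phiN); rewrite memv_img ?memv_pi.
have eN : phi (daddv_pi VN VR u) = v - phi (daddv_pi VR VN u).
  by rewrite -phiu -{2}eu linearD /= addrC addKr.
have : phi (daddv_pi VN VR u) \in (VR :&: VN)%VS.
  by rewrite memv_cap pNN andbT eN rpredB.
by rewrite VRN0 memv0 eN subr_eq0 => /eqP.
Qed.

Section Degeneration.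
Variables (K : fieldType) (V : vectType K).

(* The structure maps of f.H for f invertible, by transport of structure.      *)
Definition act_mul (f : 'End(V)) (mu : 'Hom(tens V V, V)) :
  'Hom(tens V V, V) := (f^-1 \o mu \o (f ⊠ f))%VF.
Definition act_comul (f : 'End(V)) (Delta : 'Hom(V, tens V V)) :
  'Hom(V, tens V V) := ((f^-1 ⊠ f^-1) \o Delta \o f)%VF.
Definition act_unit (f : 'End(V)) (eta : 'Hom(K^o, V)) :
  'Hom(K^o, V) := (f^-1 \o eta)%VF.
Definition act_counit (f : 'End(V)) (eps : 'Hom(V, K^o)) :
  'Hom(V, K^o) := (eps \o f)%VF.
Definition act_antipode (f : 'End(V)) (S : 'End(V)) : 'End(V) :=
  (f^-1 \o S \o f)%VF.

Definition deform (phi : 'End(V)) (t : K) : 'End(V) := phi + t *: \1%VF.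

End Degeneration.

(* c agrees, off finitely many t, with the rational function p / q, which is   *)
(* regular at 0 with value l there.  Finitely many exceptions are needed since *)
(* deform phi t is not invertible for t = 0 and when - t is an eigenvalue of   *)
(* phi; over an infinite field the rational function is determined by c.       *)
Definition rat_lim0 (K : fieldType) (c : K -> K) (l : K) : Prop :=
  exists p q : {poly K}, [/\ q.[0] != 0, l = p.[0] / q.[0]
    & exists s : seq K, forall t, t \notin s -> c t = p.[t] / q.[t]].

(* Limit at t = 0 of a family of vectors, coordinate by coordinate; for a      *)
(* family of linear maps the coordinates are the structure constants.          *)
Definition lim0 (K : fieldType) (W : vectType K) (F : K -> W) (L : W) : Prop :=
  forall i, rat_lim0 (fun t => coord (vbasis {:W}) i (F t))
                     (coord (vbasis {:W}) i L).

Definition degeneration_exists (K : fieldType) (V : vectType K)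
    (f : K -> 'End(V)) (mu : 'Hom(tens V V, V)) (Delta : 'Hom(V, tens V V)) :
    Prop :=
  (exists mu0, lim0 (fun t => act_mul (f t) mu) mu0) /\
  (exists Delta0, lim0 (fun t => act_comul (f t) Delta) Delta0).

Section Conditions.
Variables (K : fieldType) (V : vectType K) (phi : 'End(V)).
Variables (VR VN : {vspace V}).
Variables (mu : 'Hom(tens V V, V)) (Delta : 'Hom(V, tens V V)).

Let pR : 'End(V) := daddv_pi VR VN.
Let pN : 'End(V) := daddv_pi VN VR.
Let phiV : 'End(V) := fitting_inv phi VR VN.

Definition mul_condition : Prop := forall x y : V,
  phi (phi (pN (mu (x ⊗ y)))) - phi (pN (mu (phi x ⊗ y)))
  - phi (pN (mu (x ⊗ phi y))) + pN (mu (phi x ⊗ phi y)) = 0.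

Definition comul_condition : Prop := forall x : V,
  [/\ (pR ⊠ (phi \o pN)%VF) (Delta x) - (pR ⊠ pN) (Delta (phi x)) = 0,
      ((phi \o pN)%VF ⊠ pR) (Delta x) - (pN ⊠ pR) (Delta (phi x)) = 0,
      (pN ⊠ pN) (Delta x) = 0
    & (pN ⊠ pN) (Delta (phi x)) - (pN ⊠ (phi \o pN)%VF) (Delta x) = 0].

Definition mul0 : 'Hom(tens V V, V) :=
  ((phiV \o pR \o mu \o (phi ⊠ phi)) + (pN \o mu \o (phi ⊠ \1))
   + (pN \o mu \o (\1 ⊠ phi)) - (phi \o pN \o mu))%VF.

Definition comul0 : 'Hom(V, tens V V) :=
  ((((phiV \o pR) ⊠ (phiV \o pR)) \o Delta \o phi)
   + (((phiV \o pR) ⊠ pN) \o Delta)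
   + ((pN ⊠ (phiV \o pR)) \o Delta))%VF.

Lemma mul0E (x y : V) :
  mul0 (x ⊗ y) = phiV (pR (mu (phi x ⊗ phi y))) + pN (mu (phi x ⊗ y))
                 + pN (mu (x ⊗ phi y)) - phi (pN (mu (x ⊗ y))).
Proof.
by rewrite /mul0 !(add_lfunE, opp_lfunE) !comp_lfunE !tmapE !id_lfunE.
Qed.

End Conditions.

(* Main.v *)
Require Import Defs.
From HB Require Import structures.
From mathcomp Require Import all_boot all_order all_algebra.
From mathcomp Require Import ring.

Set Implicit Arguments.
Unset Strict Implicit.
Unset Printing Implicit Defensive.

Import GRing.Theory passmx.
Local Open Scope ring_scope.

(* Write f_t = phi + t and split along V = V_R + V_N.  On V_R the inverse of   *)
(* f_t tends to that of phi.  On V_N division with remainder by f_t writes     *)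
(* each component of f_t.mu and f_t.Delta as a regular term plus f_t^-1 of a   *)
(* constant defect; as phi is nilpotent on V_N, f_t^-1 of a constant is        *)
(* regular at 0 only if the constant is 0, so conditions (i) and (ii) express  *)
(* that the defects vanish.                                                    *)
(* The bialgebra identity passes to the limit.  For the antipode, the          *)
(* convolution algebra End(V) is finite-dimensional, so the inverse S of id is *)
(* a polynomial in id with constant coefficients.  The same polynomial gives   *)
(* the antipode of f_t.H for every t, hence it has a limit.                    *)

(** On [VN] one can substitute [t = f_t - phi]. The [VN]-component of [mu (f_t x ⊗ f_t y)] is
    quadratic in [t], and its remainder modulo [f_t] is the left side of (i); so [act_mul_split]
    writes f_t.mu as a convergent family plus [f_t^-1] of this remainder. For [Delta], multiplying
    by [f_t] on one tensor factor leaves a single inverse, and [splitr] and [splitl] carry out the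
    same division there. Up to sign, their remainders are the first, second and fourth lines of
    (ii). Once the fourth holds, the [VN ⊗ VN] component of f_t.Delta is [f_t^-1 ⊠ \1] applied to
    that of [Delta], which gives the third line. In each case [nilpotent_resolvent_lim0] turns
    convergence into vanishing, and [lim0_deform_inv_pR] supplies the limit of what remains.

    The identities hold in f_t.H for all but finitely many [t]. They pass to the limit because
    limits are unique ([lim0_unique]) and compatible with composition and tensor products
    ([lim0_bilinear]). Convergence of the antipode comes from [antipode_polynomial]: conjugation by
    [f_t] respects convolution, so the coefficients do not depend on [t] ([lim0_antipode]). *)

Section TensorMapTheory.
Variable K : fieldType.
Implicit Types (U V W X Y Z : vectType K).

(** * Bilinearity and functoriality of the tensor product *)

Lemma tpureDl V W (v v' : V) (w : W) : (v + v') ⊗ w = v ⊗ w + v' ⊗ w.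
Proof. by have := tpure_linearl w 1 v v'; rewrite !scale1r. Qed.

Lemma tpureDr V W (v : V) (w w' : W) : v ⊗ (w + w') = v ⊗ w + v ⊗ w'.
Proof. by have := tpure_linearr v 1 w w'; rewrite !scale1r. Qed.

Lemma tpure0l V W (w : W) : (0 : V) ⊗ w = 0.
Proof. by apply/matrixP => i j; rewrite !mxE linear0 mul0r. Qed.

Lemma tpure0r V W (v : V) : v ⊗ (0 : W) = 0.
Proof. by apply/matrixP => i j; rewrite !mxE linear0 mulr0. Qed.

Lemma tpureZl V W a (v : V) (w : W) : (a *: v) ⊗ w = a *: (v ⊗ w).
Proof. by have := tpure_linearl w a v 0; rewrite tpure0l !addr0. Qed.

Lemma tpureZr V W a (v : V) (w : W) : v ⊗ (a *: w) = a *: (v ⊗ w).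
Proof. by have := tpure_linearr v a w 0; rewrite tpure0r !addr0. Qed.

(** The diagonal coordinates of [v ⊗ v] are the squares of those of [v]. This will force the unit
    into [VR]. *)
Lemma tpure_sqr_eq0 V (v : V) : v ⊗ v = 0 -> v = 0.
Proof.
move=> vv; rewrite [v](coord_vbasis (memvf v)) big1 // => i _.
have /matrixP/(_ i i) := vv; rewrite !mxE => /eqP.
by rewrite mulf_eq0 orbb => /eqP ->; rewrite scale0r.
Qed.

Lemma tmap_comp U V W X Y Z (f' : 'Hom(V, W)) (g' : 'Hom(Y, Z))
    (f : 'Hom(U, V)) (g : 'Hom(X, Y)) :
  ((f' ⊠ g') \o (f ⊠ g))%VF = (f' \o f)%VF ⊠ (g' \o g)%VF.
Proof. by apply: tensP => u x; rewrite !(comp_lfunE, tmapE). Qed.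

Lemma tmap1 V W : (\1%VF : 'End(V)) ⊠ (\1%VF : 'End(W)) = \1%VF.
Proof. by apply: tensP => v w; rewrite tmapE !id_lfunE. Qed.

Lemma tmap0l V W X Y (g : 'Hom(W, Y)) : (0 : 'Hom(V, X)) ⊠ g = 0.
Proof. by apply: tensP => v w; rewrite tmapE !zero_lfunE tpure0l. Qed.

Lemma tmap0r V W X Y (f : 'Hom(V, X)) : f ⊠ (0 : 'Hom(W, Y)) = 0.
Proof. by apply: tensP => v w; rewrite tmapE !zero_lfunE tpure0r. Qed.

Lemma tmap_linearl V W X Y (g : 'Hom(W, Y)) :
  linear (fun f : 'Hom(V, X) => f ⊠ g).
Proof.
move=> a f f'; apply: tensP => v w; rewrite add_lfunE scale_lfunE !tmapE.
by rewrite add_lfunE scale_lfunE tpure_linearl.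
Qed.

Lemma tmap_linearr V W X Y (f : 'Hom(V, X)) :
  linear (fun g : 'Hom(W, Y) => f ⊠ g).
Proof.
move=> a g g'; apply: tensP => v w; rewrite add_lfunE scale_lfunE !tmapE.
by rewrite add_lfunE scale_lfunE tpure_linearr.
Qed.

Lemma tmapDl V W X Y (f f' : 'Hom(V, X)) (g : 'Hom(W, Y)) :
  (f + f') ⊠ g = f ⊠ g + f' ⊠ g.
Proof. by have := tmap_linearl g 1 f f'; rewrite !scale1r. Qed.

Lemma tmapDr V W X Y (f : 'Hom(V, X)) (g g' : 'Hom(W, Y)) :
  f ⊠ (g + g') = f ⊠ g + f ⊠ g'.
Proof. by have := tmap_linearr f 1 g g'; rewrite !scale1r. Qed.

Lemma tmapZl V W X Y a (f : 'Hom(V, X)) (g : 'Hom(W, Y)) :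
  (a *: f) ⊠ g = a *: (f ⊠ g).
Proof. by have := tmap_linearl g a f 0; rewrite tmap0l !addr0. Qed.

Lemma tmapZr V W X Y a (f : 'Hom(V, X)) (g : 'Hom(W, Y)) :
  f ⊠ (a *: g) = a *: (f ⊠ g).
Proof. by have := tmap_linearr f a g 0; rewrite tmap0r !addr0. Qed.

Lemma tlift_linear U V W X (b : X -> V -> W -> U) s :
  (forall v w, linear (fun x => b x v w)) -> linear (fun x => tlift (b x) s).
Proof.
move=> bl a x y; rewrite !tliftT /tlift_fun scaler_sumr -big_split.
apply: eq_bigr => i _; rewrite scaler_sumr -big_split /=.
by apply: eq_bigr => j _; rewrite bl scalerDr !scalerA mulrC.
Qed.

Lemma tassocE V (x y z : V) : tassoc V ((x ⊗ y) ⊗ z) = x ⊗ (y ⊗ z).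
Proof.
rewrite /tassoc tliftE => [|w|s]; last 2 first.
- exact: linearP.
- apply: tlift_linear => v w a u u'.
  by rewrite tpure_linearr tpure_linearr.
rewrite tliftE // => [w|v] a u u'; first exact: tpure_linearl.
by rewrite tpure_linearl tpure_linearr.
Qed.

Lemma tmidE V (a b c d : V) :
  tmid V ((a ⊗ b) ⊗ (c ⊗ d)) = (a ⊗ c) ⊗ (b ⊗ d).
Proof.
have inner (x y : V) : tlift (fun c d => (x ⊗ c) ⊗ (y ⊗ d)) (c ⊗ d)
    = (x ⊗ c) ⊗ (y ⊗ d).
  rewrite tliftE // => [w|v] k u u'; first by rewrite tpure_linearr tpure_linearl.
  by rewrite !tpure_linearr.
rewrite /tmid tliftE => [|w|s]; last 2 first.
- exact: linearP.
- by apply: tlift_linear => v w; apply: linearP.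
rewrite tliftE ?inner // => w.
  by apply: tlift_linear => v v' k u u'; rewrite !tpure_linearl.
by apply: tlift_linear => v v' k u u'; rewrite tpure_linearl tpure_linearr.
Qed.

Lemma tens3P U V W X (f g : 'Hom(tens (tens U V) W, X)) :
  (forall u v w, f ((u ⊗ v) ⊗ w) = g ((u ⊗ v) ⊗ w)) -> f = g.
Proof.
move=> fg; apply: tensP => s w.
pose r : 'Hom(tens U V, tens (tens U V) W) := linfun (fun s => s ⊗ w).
have rE s' : r s' = s' ⊗ w.
  by rewrite (lfunE (HB.pack (fun s : tens U V => s ⊗ w)
    (GRing.isLinear.Build _ _ _ _ _ (tpure_linearl w)))).
rewrite -!rE -!comp_lfunE; congr ((_ : 'Hom(_, _)) _).
by apply: tensP => u v; rewrite !comp_lfunE rE fg.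
Qed.

Lemma tens4P U V W X Y (f g : 'Hom(tens (tens U V) (tens W X), Y)) :
  (forall u v w x, f ((u ⊗ v) ⊗ (w ⊗ x)) = g ((u ⊗ v) ⊗ (w ⊗ x))) -> f = g.
Proof.
move=> fg; apply: tens3P => u v s.
pose r : 'Hom(tens W X, tens (tens U V) (tens W X)) := linfun (tpure (u ⊗ v)).
have rE s' : r s' = (u ⊗ v) ⊗ s'.
  by rewrite (lfunE (HB.pack (tpure (u ⊗ v))
    (GRing.isLinear.Build _ _ _ _ _ (tpure_linearr (u ⊗ v))))).
rewrite -!rE -!comp_lfunE; congr ((_ : 'Hom(_, _)) _).
by apply: tensP => w x; rewrite !comp_lfunE rE fg.
Qed.

(** Naturality of the twist lets [f] and its inverse cancel across it in the transported bialgebra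
    identity. *)
Lemma tmid_natural V (f : 'End(V)) :
  (((f ⊠ f) ⊠ (f ⊠ f)) \o tmid V = tmid V \o ((f ⊠ f) ⊠ (f ⊠ f)))%VF.
Proof.
by apply: tens4P => a b c d; rewrite !comp_lfunE tmidE !tmapE tmidE.
Qed.

End TensorMapTheory.

(** * Limits at 0 of rational functions *)

Section RationalLimits.
Variable K : closedFieldType.
Implicit Types (P Q : K -> Prop) (p q : {poly K}) (c d : K -> K).

Definition cofinitely P := exists s : seq K, forall t, t \notin s -> P t.

Lemma cofinitely_mono P Q :
  (forall t, P t -> Q t) -> cofinitely P -> cofinitely Q.
Proof. by move=> PQ [s Ps]; exists s => t /Ps /PQ. Qed.

Lemma cofinitely_all P : (forall t, P t) -> cofinitely P.
Proof. by move=> allP; exists [::] => t _; apply: allP. Qed.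

Lemma cofinitely_and P Q :
  cofinitely P -> cofinitely Q -> cofinitely (fun t => P t /\ Q t).
Proof.
move=> [s Ps] [r Qr]; exists (s ++ r) => t.
by rewrite mem_cat negb_or => /andP[/Ps ? /Qr].
Qed.

Lemma cofinitely_neq0 : cofinitely (fun t => t != 0).
Proof. by exists [:: 0] => t; rewrite inE. Qed.

Lemma cofinitely_nonroot p : p != 0 -> cofinitely (fun t => p.[t] != 0).
Proof.
move=> p0; have [r ->] := closed_field_poly_normal p; exists r => t.
by rewrite hornerZ mulf_eq0 lead_coef_eq0 (negPf p0) -/(root _ t) root_prod_XsubC.
Qed.

Lemma cofinitely_nonroot0 p :
  p.[0] != 0 -> cofinitely (fun t => p.[t] != 0).
Proof.
by move=> p0; apply: cofinitely_nonroot; apply: contraNneq p0 => ->; rewrite horner0.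
Qed.

(** An algebraically closed field is infinite: a root of [\prod_z ('X - z) + 1] differs from every
    [z]. *)
Lemma cofinitely_ex P : cofinitely P -> exists t, P t.
Proof.
(* The extra factor for 0 keeps [p] nonconstant when [s] is empty. *)
case=> s Ps; pose p : {poly K} := \prod_(z <- 0 :: s) ('X - z%:P) + 1.
have sp : size p != 1.
  by rewrite size_polyDl size_prod_XsubC ?size_poly1.
have [t /rootP pt] := closed_rootP p sp; exists t; apply: Ps.
apply/negP => ts; move: pt; rewrite hornerD hornerC.
have -> : (\prod_(z <- 0 :: s) ('X - z%:P)).[t] = 0.
  by apply/rootP; rewrite root_prod_XsubC inE ts orbT.
by rewrite add0r => /eqP; rewrite oner_eq0.
Qed.

(** Adding the roots of [q] to the exceptions allows denominators to be cleared. *)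
Lemma rat_lim0P c l : rat_lim0 c l -> exists p q, [/\ q.[0] != 0,
  l = p.[0] / q.[0] & cofinitely (fun t => q.[t] != 0 /\ c t = p.[t] / q.[t])].
Proof.
case=> p [q [q0 lE cE]]; exists p, q; split=> //.
exact: cofinitely_and (cofinitely_nonroot0 q0) cE.
Qed.

Lemma rat_lim0_ext c d l :
  cofinitely (fun t => c t = d t) -> rat_lim0 c l -> rat_lim0 d l.
Proof.
move=> cd [p [q [q0 lE cE]]]; exists p, q; split=> //.
by apply: cofinitely_mono (cofinitely_and cd cE) => t [<-].
Qed.

Lemma rat_lim0_cst l : rat_lim0 (fun _ : K => l) l.
Proof.
exists l%:P, 1; rewrite !hornerC oner_eq0 divr1; split=> //.
by exists [::] => t _; rewrite !hornerC divr1.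
Qed.

Lemma rat_lim0_id : rat_lim0 (fun t : K => t) (0 : K).
Proof.
exists 'X, 1; rewrite hornerX !hornerC oner_eq0 divr1; split=> //.
by exists [::] => t _; rewrite hornerX hornerC divr1.
Qed.

Lemma rat_lim0D c d k l :
  rat_lim0 c k -> rat_lim0 d l -> rat_lim0 (fun t => c t + d t) (k + l).
Proof.
move=> /rat_lim0P[p [q [q0 -> cE]]] /rat_lim0P[p' [q' [q'0 -> dE]]].
exists (p * q' + p' * q), (q * q').
rewrite !(hornerD, hornerM) mulf_neq0 // addf_div //.
split=> //; apply: cofinitely_mono (cofinitely_and cE dE).
by move=> t [[qt ->] [q't ->]]; rewrite !(hornerD, hornerN, hornerM) addf_div.
Qed.

Lemma rat_lim0M c d k l :
  rat_lim0 c k -> rat_lim0 d l -> rat_lim0 (fun t => c t * d t) (k * l).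
Proof.
move=> [p [q [q0 -> cE]]] [p' [q' [q'0 -> dE]]].
exists (p * p'), (q * q'); rewrite !hornerM mulf_neq0 // mulf_div.
split=> //; apply: cofinitely_mono (cofinitely_and cE dE).
by move=> t [-> ->]; rewrite !hornerM mulf_div.
Qed.

Lemma rat_lim0_sum (I : Type) (r : seq I) (P : pred I) (c : I -> K -> K) l :
  (forall i, P i -> rat_lim0 (c i) (l i)) ->
  rat_lim0 (fun t => \sum_(i <- r | P i) c i t) (\sum_(i <- r | P i) l i).
Proof.
move=> cl; elim: r => [|i r IH].
  by apply: rat_lim0_ext (rat_lim0_cst _); exists [::] => t _; rewrite !big_nil.
rewrite big_cons; case: ifP => Pi.
  apply: rat_lim0_ext (rat_lim0D (cl i Pi) IH).
  by exists [::] => t _; rewrite big_cons Pi.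
by apply: rat_lim0_ext IH; exists [::] => t _; rewrite big_cons Pi.
Qed.

Lemma rat_lim0_prod (I : Type) (r : seq I) (P : pred I) (c : I -> K -> K) l :
  (forall i, P i -> rat_lim0 (c i) (l i)) ->
  rat_lim0 (fun t => \prod_(i <- r | P i) c i t) (\prod_(i <- r | P i) l i).
Proof.
move=> cl; elim: r => [|i r IH].
  by apply: rat_lim0_ext (rat_lim0_cst _); exists [::] => t _; rewrite !big_nil.
rewrite big_cons; case: ifP => Pi.
  apply: rat_lim0_ext (rat_lim0M (cl i Pi) IH).
  by exists [::] => t _; rewrite big_cons Pi.
by apply: rat_lim0_ext IH; exists [::] => t _; rewrite big_cons Pi.
Qed.

Lemma rat_lim0V c l :
  l != 0 -> rat_lim0 c l -> rat_lim0 (fun t => (c t)^-1) l^-1.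
Proof.
move=> l0 [p [q [q0 lE cE]]]; exists q, p; rewrite lE invf_div; split=> //.
  by apply: contraNneq l0 => p0; rewrite lE p0 mul0r.
by apply: cofinitely_mono cE => t ->; rewrite invf_div.
Qed.

(** If [p * q' - p' * q] were a nonzero polynomial, some [t] that is not a root of it would satisfy
    both formulas for [c t], a contradiction. So it is zero, and evaluating at 0 gives the claim. *)
Lemma rat_lim0_unique c k l : rat_lim0 c k -> rat_lim0 c l -> k = l.
Proof.
move=> /rat_lim0P[p [q [q0 -> cE]]] /rat_lim0P[p' [q' [q'0 -> cE']]].
have [/eqP|r0] := eqVneq (p * q' - p' * q) 0.
  rewrite subr_eq0 => /eqP/(congr1 (horner^~ 0)); rewrite !hornerM => e.
  by apply/eqP; rewrite eqr_div // e.
have [t [[[qt ->] [q't /eqP]]]] := cofinitely_ex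
  (cofinitely_and (cofinitely_and cE cE') (cofinitely_nonroot r0)).
by rewrite eqr_div // !(hornerD, hornerN, hornerM) subr_eq0 => ->.
Qed.

Lemma rat_lim0_neq0 c l :
  l != 0 -> rat_lim0 c l -> cofinitely (fun t => c t != 0).
Proof.
move=> l0 /rat_lim0P[p [q [q0 lE cE]]].
have p0 : p.[0] != 0 by apply: contraNneq l0 => p0; rewrite lE p0 mul0r.
apply: cofinitely_mono (cofinitely_and cE (cofinitely_nonroot0 p0)).
by move=> t [[qt ->] pt]; rewrite mulf_neq0 ?invr_neq0.
Qed.

Lemma rat_lim0_det n (M : K -> 'M[K]_n) (L : 'M[K]_n) :
  (forall i j, rat_lim0 (fun t => M t i j) (L i j)) ->
  rat_lim0 (fun t => \det (M t)) (\det L).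
Proof.
move=> ML; apply: rat_lim0_sum => s _; apply: rat_lim0M (rat_lim0_cst _) _.
by apply: rat_lim0_prod => i _; apply: ML.
Qed.

(** By Cramer's rule the entries of the inverse are cofactors over a determinant that does not
    vanish at 0. *)
Lemma rat_lim0_invmx n (M : K -> 'M[K]_n) (L : 'M[K]_n) : L \in unitmx ->
  (forall i j, rat_lim0 (fun t => M t i j) (L i j)) ->
  cofinitely (fun t => M t \in unitmx) /\
  forall i j, rat_lim0 (fun t => invmx (M t) i j) (invmx L i j).
Proof.
rewrite unitmxE unitfE => L0 ML; have detL := rat_lim0_det ML.
have Mu : cofinitely (fun t => M t \in unitmx).
  apply: cofinitely_mono (rat_lim0_neq0 L0 detL) => t.
  by rewrite unitmxE unitfE.
split=> // i j; apply: (@rat_lim0_ext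
    (fun t => (\det (M t))^-1 * ((-1) ^+ (j + i) * \det (row' j (col' i (M t)))))).
  by apply: cofinitely_mono Mu => t Mt; rewrite /invmx Mt !mxE.
rewrite /invmx unitmxE unitfE L0 !mxE.
apply: rat_lim0M (rat_lim0V L0 detL) (rat_lim0M (rat_lim0_cst _) _).
apply: rat_lim0_det => a b; rewrite !mxE.
by apply: rat_lim0_ext (ML _ _); apply: cofinitely_all => t; rewrite !mxE.
Qed.

End RationalLimits.

(** * Limits of families of vectors and of linear maps *)

Section VectorLimits.
Variable K : closedFieldType.
Implicit Types (U V W X Y Z : vectType K).

Lemma lim0_ext W (F G : K -> W) L :
  cofinitely (fun t => F t = G t) -> lim0 F L -> lim0 G L.
Proof.
move=> FG FL i; apply: rat_lim0_ext (FL i).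
by apply: cofinitely_mono FG => t ->.
Qed.

Lemma lim0_cst W (L : W) : lim0 (fun _ : K => L) L.
Proof. by move=> i; apply: rat_lim0_cst. Qed.

Lemma lim0D W (F G : K -> W) L M :
  lim0 F L -> lim0 G M -> lim0 (fun t => F t + G t) (L + M).
Proof.
move=> FL GM i; rewrite linearD; apply: rat_lim0_ext (rat_lim0D (FL i) (GM i)).
by apply: cofinitely_all => t; rewrite linearD.
Qed.

Lemma lim0Z W (c : K -> K) (F : K -> W) k L :
  rat_lim0 c k -> lim0 F L -> lim0 (fun t => c t *: F t) (k *: L).
Proof.
move=> ck FL i; rewrite linearZ; apply: rat_lim0_ext (rat_lim0M ck (FL i)).
by apply: cofinitely_all => t; rewrite linearZ.
Qed.

Lemma lim0N W (F : K -> W) L : lim0 F L -> lim0 (fun t => - F t) (- L).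
Proof.
move=> FL; rewrite -scaleN1r; apply: lim0_ext (lim0Z (rat_lim0_cst _) FL).
by apply: cofinitely_all => t; rewrite scaleN1r.
Qed.

Lemma lim0B W (F G : K -> W) L M :
  lim0 F L -> lim0 G M -> lim0 (fun t => F t - G t) (L - M).
Proof. by move=> FL /lim0N; apply: lim0D. Qed.

Lemma lim0_sum W (I : Type) (r : seq I) (P : pred I) (F : I -> K -> W) L :
  (forall i, P i -> lim0 (F i) (L i)) ->
  lim0 (fun t => \sum_(i <- r | P i) F i t) (\sum_(i <- r | P i) L i).
Proof.
move=> FL i; rewrite linear_sum.
have : forall j, P j -> rat_lim0 (fun t => coord (vbasis {:W}) i (F j t))
  (coord (vbasis {:W}) i (L j)) by move=> j Pj; apply: FL.
move/(rat_lim0_sum r); apply: rat_lim0_ext.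
by apply: cofinitely_all => t; rewrite linear_sum.
Qed.

Lemma lim0_unique W (F : K -> W) L M : lim0 F L -> lim0 F M -> L = M.
Proof.
move=> FL FM; rewrite [L](coord_vbasis (memvf L)) [M](coord_vbasis (memvf M)).
by apply: eq_bigr => i _; rewrite (rat_lim0_unique (FL i) (FM i)).
Qed.

(** In bases, [b] is a finite sum of products of coordinates. Evaluation, composition and [⊠] are
    all instances. *)
Lemma lim0_bilinear U V W (b : U -> V -> W) (F : K -> U) (G : K -> V) L M :
  (forall v, linear (b^~ v)) -> (forall u, linear (b u)) ->
  lim0 F L -> lim0 G M -> lim0 (fun t => b (F t) (G t)) (b L M).
Proof.
move=> bl br FL GM.
have bE u v : b u v = \sum_i \sum_j (coord (vbasis {:U}) i u *
    coord (vbasis {:V}) j v) *: b (vbasis {:U})`_i (vbasis {:V})`_j.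
  rewrite -(tliftE u v bl br) tliftT; apply: eq_bigr => i _.
  by apply: eq_bigr => j _; rewrite mxE.
rewrite bE; apply: (@lim0_ext _ (fun t => \sum_i \sum_j
    (coord (vbasis {:U}) i (F t) * coord (vbasis {:V}) j (G t))
      *: b (vbasis {:U})`_i (vbasis {:V})`_j)).
  by apply: cofinitely_all => t; rewrite bE.
apply: lim0_sum => i _; apply: lim0_sum => j _.
exact: lim0Z (rat_lim0M (FL i) (GM j)) (lim0_cst _).
Qed.

Lemma lim0_app V W (F : K -> 'Hom(V, W)) (v : K -> V) L l :
  lim0 F L -> lim0 v l -> lim0 (fun t => F t (v t)) (L l).
Proof.
apply: (@lim0_bilinear _ _ _ (fun (f : 'Hom(V, W)) x => f x)).
  by move=> x a f g; rewrite add_lfunE scale_lfunE.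
by move=> f; apply: linearP.
Qed.

Lemma lim0_comp U V W (F : K -> 'Hom(V, W)) (G : K -> 'Hom(U, V)) L M :
  lim0 F L -> lim0 G M -> lim0 (fun t => (F t \o G t)%VF) (L \o M)%VF.
Proof.
apply: (@lim0_bilinear _ _ _ (fun (f : 'Hom(V, W)) (g : 'Hom(U, V)) => f \o g)%VF).
  by move=> g a f f'; rewrite comp_lfunDl comp_lfunZl.
by move=> f a g g'; rewrite comp_lfunDr comp_lfunZr.
Qed.

Lemma lim0_tmap V W X Y (F : K -> 'Hom(V, X)) (G : K -> 'Hom(W, Y)) L M :
  lim0 F L -> lim0 G M -> lim0 (fun t => F t ⊠ G t) (L ⊠ M).
Proof.
apply: (@lim0_bilinear _ _ _ (fun (f : 'Hom(V, X)) (g : 'Hom(W, Y)) => f ⊠ g)).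
  by move=> g; apply: tmap_linearl.
by move=> f; apply: tmap_linearr.
Qed.

Lemma inv_lfun_unique V (f g : 'End(V)) : (f \o g = \1)%VF ->
  lker f == 0%VS /\ g = f^-1%VF.
Proof.
move=> fg; have kg : lker g == 0%VS.
  by apply/lker0P => u v e; rewrite -[u]id_lfunE -[v]id_lfunE -fg !comp_lfunE e.
have gf : (g \o f = \1)%VF.
  by rewrite -[LHS]comp_lfun1r -(lker0_compfV kg) comp_lfunA -(comp_lfunA g f) fg
    comp_lfun1r.
have kf : lker f == 0%VS.
  by apply/lker0P => u v e; rewrite -[u]id_lfunE -[v]id_lfunE -gf !comp_lfunE e.
by split=> //; rewrite -[LHS](lker0_compKf kf) fg comp_lfun1r.
Qed.

Lemma lim0_inv_lfun V (F : K -> 'End(V)) (L : 'End(V)) : lker L == 0%VS ->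
  lim0 F L -> cofinitely (fun t => lker (F t) == 0%VS) /\
  lim0 (fun t => (F t)^-1%VF) L^-1%VF.
Proof.
move=> kL FL; pose e := vbasis {:V}.
have eB : basis_of {:V} e := vbasisP _.
have eF := basis_free eB.
have LE : mxof e e L *m mxof e e L^-1%VF = 1%:M.
  by rewrite -mxof_comp // lker0_compVf // mxof1.
have [Lu _] := mulmx1_unit LE.
have iLE : invmx (mxof e e L) = mxof e e L^-1%VF.
  by rewrite -[LHS]mulmx1 -LE mulKmx.
have ML i j : rat_lim0 (fun t => mxof e e (F t) i j) (mxof e e L i j).
  have := lim0_app FL (lim0_cst (vecof e (delta_mx 0 i))) => /(_ j).
  by rewrite !mxE; apply: rat_lim0_ext; apply: cofinitely_all => t; rewrite !mxE.
have [Fu iF] := rat_lim0_invmx Lu ML.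
have inv t : mxof e e (F t) \in unitmx ->
    lker (F t) == 0%VS /\ hommx e e (invmx (mxof e e (F t))) = (F t)^-1%VF.
  move=> u; apply: inv_lfun_unique; apply: esym.
  have := hommx_mul eB eB eB (invmx (mxof e e (F t))) (mxof e e (F t)).
  by rewrite mulVmx // mxofK // hommx1.
split; first by apply: cofinitely_mono Fu => t /inv[].
have -> : L^-1%VF = hommx e e (invmx (mxof e e L)) by rewrite iLE mxofK.
apply: (@lim0_ext _ (fun t => hommx e e (invmx (mxof e e (F t))))).
  by apply: cofinitely_mono Fu => t /inv[].
(* Expanding over elementary matrices turns entrywise limits into a limit of maps. *)
have hE M : hommx e e M = \sum_i \sum_j M i j *: hommx e e (delta_mx i j).
  rewrite {1}[M]matrix_sum_delta linear_sum; apply: eq_bigr => i _.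
  by rewrite linear_sum; apply: eq_bigr => j _; rewrite linearZ.
rewrite hE; apply: (@lim0_ext _ (fun t => \sum_i \sum_j
    invmx (mxof e e (F t)) i j *: hommx e e (delta_mx i j))).
  by apply: cofinitely_all => t; rewrite [RHS]hE.
by apply: lim0_sum => i _; apply: lim0_sum => j _; apply: lim0Z (lim0_cst _).
Qed.

End VectorLimits.

(** * The Fitting projections and the inverse of [deform phi t] near 0 *)

Section Resolvent.
Variable K : closedFieldType.

Lemma deformE (V : vectType K) (phi : 'End(V)) t v :
  deform phi t v = phi v + t *: v.
Proof. by rewrite /deform add_lfunE scale_lfunE id_lfunE. Qed.

(* Over a nilpotent operator the resolvent has no constant term in t^-1, so it *)
(* is regular at 0 only on the zero vector.                                    *)
Lemma nilpotent_resolvent_lim0 (W : vectType K) (n : 'End(W))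
    (G : K -> 'End(W)) m D E :
  cofinitely (fun t => G t \o deform n t = \1)%VF ->
  iter m n D = 0 -> lim0 (fun t => G t D) E -> D = 0.
Proof.
move=> Gn; elim: m D E => [|m IH] D E //; rewrite iterSr => nD GD.
(* As [t *: G t D] tends to 0, this identity shows that [G t (n D)] tends to [D], so the induction
   hypothesis applies to [n D]. *)
have GnD : cofinitely (fun t => D = G t (n D) + t *: G t D).
  apply: cofinitely_mono Gn => t /lfunP/(_ D).
  by rewrite comp_lfunE deformE id_lfunE linearD linearZ.
have tGD := lim0Z (rat_lim0_id K) GD; rewrite scale0r in tGD.
have nD0 : n D = 0.
  apply: IH nD _; apply: lim0_ext (lim0B (lim0_cst D) tGD).
  by apply: cofinitely_mono GnD => t {1}->; rewrite addrK.
(* With [n D = 0], the constant [D] equals [t *: G t D], whose limit is 0. *)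
apply: (lim0_unique (lim0_cst D)); apply: lim0_ext tGD.
by apply: cofinitely_mono GnD => t {2}->; rewrite nD0 linear0 add0r.
Qed.

Lemma inv_lfun_comm (V : vectType K) (f a : 'End(V)) : lker f == 0%VS ->
  (f \o a = a \o f)%VF -> (f^-1 \o a = a \o f^-1)%VF.
Proof.
move=> kf fa; rewrite -[a in LHS](lker0_compfK kf) -fa -comp_lfunA.
exact: lker0_compKf.
Qed.

Variables (V : vectType K) (phi : 'End(V)) (VR VN : {vspace V}).
Hypothesis fitting_phi : is_fitting phi VR VN.

Local Notation pR := (daddv_pi VR VN).
Local Notation pN := (daddv_pi VN VR).
Local Notation phiV := (fitting_inv phi VR VN).
Local Notation f := (deform phi).

Let capRN : (VR :&: VN = 0)%VS := fitting_cap fitting_phi.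
Let capNR : (VN :&: VR = 0)%VS. Proof. by rewrite capvC. Qed.

Lemma fitting_split v : pR v + pN v = v.
Proof. by apply: daddv_pi_add => //; rewrite (fitting_add fitting_phi) memvf. Qed.

Lemma fitting_projD : pR + pN = \1%VF :> 'End(V).
Proof. by apply/lfunP => v; rewrite add_lfunE id_lfunE fitting_split. Qed.

Lemma pR_id v : v \in VR -> pR v = v. Proof. exact: daddv_pi_id. Qed.
Lemma pN_id v : v \in VN -> pN v = v. Proof. exact: daddv_pi_id. Qed.

Lemma pRN v : v \in VN -> pR v = 0.
Proof.
move=> /pN_id vN; have := fitting_split v; rewrite vN => /(canRL (addrK _)).
by rewrite subrr.
Qed.

Lemma pNR v : v \in VR -> pN v = 0.
Proof.
move=> /pR_id vR; have := fitting_split v; rewrite vR => /(canRL (addKr _)).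
by rewrite addNr.
Qed.

Lemma pR_pR : (pR \o pR)%VF = pR.
Proof. by apply/lfunP => v; rewrite comp_lfunE pR_id ?memv_pi. Qed.

Lemma pN_pN : (pN \o pN)%VF = pN.
Proof. by apply/lfunP => v; rewrite comp_lfunE pN_id ?memv_pi. Qed.

Lemma pN_pR : (pN \o pR = 0)%VF.
Proof. by apply/lfunP => v; rewrite comp_lfunE zero_lfunE pNR ?memv_pi. Qed.

Lemma phi_VR v : v \in VR -> phi v \in VR.
Proof. by move=> vR; rewrite -(fitting_surj fitting_phi) memv_img. Qed.

Lemma phi_VN v : v \in VN -> phi v \in VN.
Proof. by move=> vN; apply: (subvP (fitting_stab fitting_phi)); rewrite memv_img. Qed.

Lemma phi_pR v : phi (pR v) = pR (phi v).
Proof.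
rewrite -{2}[v]fitting_split !linearD /= [pR (phi (pN v))]pRN ?phi_VN ?memv_pi //.
by rewrite addr0 [pR (phi _)]pR_id ?phi_VR ?memv_pi.
Qed.

Lemma phi_pN v : phi (pN v) = pN (phi v).
Proof.
rewrite -{2}[v]fitting_split !linearD /= [pN (phi (pR v))]pNR ?phi_VR ?memv_pi //.
by rewrite add0r [pN (phi _)]pN_id ?phi_VN ?memv_pi.
Qed.

Lemma deform_pR t : (f t \o pR = pR \o f t)%VF.
Proof. by apply/lfunP => v; rewrite !comp_lfunE !deformE linearD linearZ phi_pR. Qed.

Lemma deform_pN t : (f t \o pN = pN \o f t)%VF.
Proof. by apply/lfunP => v; rewrite !comp_lfunE !deformE linearD linearZ phi_pN. Qed.

Lemma lim0_deform : lim0 f phi.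
Proof.
rewrite -[X in lim0 _ X]addr0 -(scale0r (\1%VF : 'End(V))).
exact: lim0D (lim0_cst _) (lim0Z (rat_lim0_id K) (lim0_cst _)).
Qed.

(* Agrees with deform phi t on VR, but stays invertible at t = 0.              *)
Let g (t : K) : 'End(V) := (phi \o pR + pN + t *: pR)%VF.

Let gE t v : g t v = phi (pR v) + pN v + t *: pR v.
Proof. by rewrite /g !add_lfunE comp_lfunE scale_lfunE. Qed.

Let pR_g t : (pR \o g t = f t \o pR)%VF.
Proof.
apply/lfunP => v; rewrite !comp_lfunE gE deformE !linearD linearZ /=.
rewrite [pR (pN v)]pRN ?memv_pi // addr0 [pR (phi _)]pR_id ?phi_VR ?memv_pi //.
by rewrite [pR (pR v)]pR_id ?memv_pi.
Qed.

Let g_pR t : (g t \o pR = f t \o pR)%VF.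
Proof.
apply/lfunP => v; rewrite !comp_lfunE gE deformE.
by rewrite [pR (pR v)]pR_id ?memv_pi // pNR ?memv_pi // addr0.
Qed.

Let g0_inv : lker (g 0) == 0%VS /\ (phiV \o pR + pN)%VF = (g 0)^-1%VF.
Proof.
apply: inv_lfun_unique; apply/lfunP => v.
rewrite comp_lfunE gE scale0r addr0 add_lfunE comp_lfunE id_lfunE.
have [] := fitting_invP fitting_phi (memv_pi VR VN v).
move: (phiV (pR v)) => w iR phi_i; rewrite !linearD /=.
rewrite (pR_id iR) phi_i [pR (pN v)]pRN ?memv_pi // linear0 addr0.
by rewrite (pNR iR) add0r pN_id ?memv_pi // fitting_split.
Qed.

Let lim_g : lim0 g (g 0).
Proof. exact: lim0D (lim0_cst _) (lim0Z (rat_lim0_id K) (lim0_cst _)). Qed.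

Let g_invertible : cofinitely (fun t => lker (g t) == 0%VS) :=
  proj1 (lim0_inv_lfun (proj1 g0_inv) lim_g).

(** A kernel vector has zero [VR]-part, since [f t] agrees there with the invertible [g t]. It is
    then an eigenvector of [phi] in [VN] for [- t], which nilpotency excludes when [t] is
    nonzero. *)
Lemma deform_invertible : cofinitely (fun t => lker (f t) == 0%VS).
Proof.
apply: cofinitely_mono (cofinitely_and g_invertible (cofinitely_neq0 K)).
move=> t [/lker0P kg t0].
have kf v : f t v = 0 -> v = 0.
  move=> fv; have pRv : pR v = 0.
    apply: kg; rewrite linear0 -comp_lfunE g_pR deform_pR comp_lfunE fv.
    exact: linear0.
  have [m /(_ (pN v) (memv_pi _ _ _))] := fitting_nil fitting_phi.
  have vN : pN v = v by rewrite -[RHS]fitting_split pRv add0r.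
  have itE k : iter k phi v = (- t) ^+ k *: v.
    elim: k => [|k IH]; first by rewrite expr0 scale1r.
    rewrite iterS IH linearZ /=; move/eqP: fv; rewrite deformE addr_eq0 => /eqP ->.
    by rewrite -scaleNr scalerA exprSr.
  rewrite vN itE => /eqP; rewrite scaler_eq0 expf_eq0 oppr_eq0 (negPf t0) andbF.
  by move/eqP.
apply/lker0P => u v e; apply/eqP; rewrite -subr_eq0; apply/eqP/kf.
by rewrite linearB /= e subrr.
Qed.

(** On [VR] the inverse of [f t] is that of [g t], which is regular at 0 because [g 0] is
    invertible. *)
Lemma lim0_deform_inv_pR : lim0 (fun t => (f t)^-1 \o pR)%VF (phiV \o pR)%VF.
Proof.
have [kg0 gV] := g0_inv; have [_ ig] := lim0_inv_lfun kg0 lim_g.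
have -> : (phiV \o pR = (g 0)^-1 \o pR)%VF.
  by rewrite -gV comp_lfunDl -(comp_lfunA phiV) pR_pR pN_pR addr0.
apply: lim0_ext (lim0_comp ig (lim0_cst _)).
apply: cofinitely_mono (cofinitely_and g_invertible deform_invertible).
move=> t [kg kf]; rewrite (inv_lfun_comm kg); last by rewrite g_pR pR_g.
rewrite -[pR in LHS](lker0_compKf kf) -pR_g comp_lfunA.
by rewrite lker0_compfK.
Qed.

Lemma pN_nilpotent : exists m, forall v, iter m phi (pN v) = 0.
Proof.
have [m nil] := fitting_nil fitting_phi; exists m => v.
by apply: nil; apply: memv_pi.
Qed.

(** The resolvent lemma asks only that some power of [phi] kill [D], so [phi] need not be restricted
    to [VN]. *)
Lemma deform_inv_lim0_eq0 D E : D \in VN ->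
  lim0 (fun t => (f t)^-1%VF D) E -> D = 0.
Proof.
move=> DN; have [m /(_ D)] := pN_nilpotent; rewrite pN_id //.
apply: nilpotent_resolvent_lim0.
by apply: cofinitely_mono deform_invertible => t /lker0_compVf.
Qed.

Lemma iter_tmapr W (T : tens W V) m :
  iter m (\1 ⊠ phi)%VF ((\1 ⊠ pN)%VF T)
    = (\1 ⊠ iter m (fun h => phi \o h)%VF pN)%VF T.
Proof.
elim: m => // m IH; rewrite !iterS IH -comp_lfunE tmap_comp.
by rewrite comp_lfun1l.
Qed.

Lemma iter_tmapl W (T : tens V W) m :
  iter m (phi ⊠ \1)%VF ((pN ⊠ \1)%VF T)
    = (iter m (fun h => phi \o h)%VF pN ⊠ \1)%VF T.
Proof.
elim: m => // m IH; rewrite !iterS IH -comp_lfunE tmap_comp.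
by rewrite comp_lfun1l.
Qed.

Lemma iter_comp_pN_eq0 : exists m, iter m (fun h => phi \o h)%VF pN = 0.
Proof.
have [m nil] := pN_nilpotent; exists m.
apply/lfunP => v; rewrite zero_lfunE -[RHS](nil v).
by elim: m {nil} => //= m IH; rewrite comp_lfunE IH.
Qed.

(** [\1 ⊠ f t] is the deformation of [\1 ⊠ phi], a power of which kills every [T] whose second
    factor lies in [VN]. *)
Lemma tmapr_deform_inv_lim0_eq0 (W : vectType K) (T : tens W V) E :
  (\1 ⊠ pN)%VF T = T ->
  lim0 (fun t => (\1 ⊠ (f t)^-1)%VF T) E -> T = 0.
Proof.
move=> TN; have [m nil] := iter_comp_pN_eq0.
apply: (@nilpotent_resolvent_lim0 _ (\1 ⊠ phi)%VF _ m).
  apply: cofinitely_mono deform_invertible => t kf.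
  by rewrite /deform -tmap1 -tmapZr -tmapDr tmap_comp lker0_compVf // comp_lfun1l.
by rewrite -TN iter_tmapr nil tmap0r zero_lfunE.
Qed.

Lemma tmapl_deform_inv_lim0_eq0 (W : vectType K) (T : tens V W) E :
  (pN ⊠ \1)%VF T = T ->
  lim0 (fun t => ((f t)^-1 ⊠ \1)%VF T) E -> T = 0.
Proof.
move=> TN; have [m nil] := iter_comp_pN_eq0.
apply: (@nilpotent_resolvent_lim0 _ (phi ⊠ \1)%VF _ m).
  apply: cofinitely_mono deform_invertible => t kf.
  by rewrite /deform -tmap1 -tmapZl -tmapDl tmap_comp lker0_compVf // comp_lfun1l.
by rewrite -TN iter_tmapl nil tmap0l zero_lfunE.
Qed.

Lemma coord_eqP (W : vectType K) (u v : W) :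
  (forall i, coord (vbasis {:W}) i u = coord (vbasis {:W}) i v) -> u = v.
Proof.
move=> uv; rewrite [u](coord_vbasis (memvf u)) [v](coord_vbasis (memvf v)).
by apply: eq_bigr => i _; rewrite uv.
Qed.

(** * Condition (i) and the limit of the multiplication *)

Section Multiplication.
Variable mu : 'Hom(tens V V, V).

(** The remainder on dividing the [VN]-component of [mu (f t x ⊗ f t y)] by [f t]: that quadratic
    polynomial evaluated at [t = - phi]. *)
Let defect : 'Hom(tens V V, V) :=
  ((phi \o (phi \o (pN \o mu))) - (phi \o (pN \o (mu \o (phi ⊠ \1))))
   - (phi \o (pN \o (mu \o (\1 ⊠ phi)))) + (pN \o (mu \o (phi ⊠ phi))))%VF.

(** The constant term in [t] of the quotient in the same division. *)
Let regular : 'Hom(tens V V, V) :=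
  ((pN \o (mu \o (phi ⊠ \1))) + (pN \o (mu \o (\1 ⊠ phi))) - (phi \o (pN \o mu)))%VF.

Let defectE x y : defect (x ⊗ y) =
  phi (phi (pN (mu (x ⊗ y)))) - phi (pN (mu (phi x ⊗ y)))
  - phi (pN (mu (x ⊗ phi y))) + pN (mu (phi x ⊗ phi y)).
Proof.
by rewrite /defect !(add_lfunE, opp_lfunE) !comp_lfunE !tmapE !id_lfunE.
Qed.

Let regularE x y : regular (x ⊗ y) =
  pN (mu (phi x ⊗ y)) + pN (mu (x ⊗ phi y)) - phi (pN (mu (x ⊗ y))).
Proof.
by rewrite /regular !(add_lfunE, opp_lfunE) !comp_lfunE !tmapE !id_lfunE.
Qed.

Let mul_conditionE : mul_condition phi VR VN mu <-> defect = 0.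
Proof.
split=> [cond|e]; last by move=> x y; rewrite -defectE e zero_lfunE.
by apply: tensP => x y; rewrite defectE zero_lfunE; apply: cond.
Qed.

Let defect_VN T : defect T \in VN.
Proof.
by rewrite /defect !(add_lfunE, opp_lfunE) !comp_lfunE !(rpredD, rpredN) //;
  do ?apply: phi_VN; rewrite memv_pi.
Qed.

Let act_mul_split t : lker (f t) == 0%VS -> act_mul (f t) mu =
  ((((f t)^-1 \o pR) \o (mu \o (f t ⊠ f t))) + t *: (pN \o mu) + regular
   + ((f t)^-1 \o defect))%VF.
Proof.
move: (f t) (deformE phi t) => F FE kf; apply: tensP => x y; apply: (lker0P kf).
move: regular regularE defect defectE => r rE d dE.
rewrite /act_mul !add_lfunE scale_lfunE !comp_lfunE tmapE rE dE.
rewrite [in RHS]linearD [in RHS]linearD [in RHS]linearD /= !(lker0_lfunVK kf).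
have /(canRL (addrK _)) -> := fitting_split (mu (F x ⊗ F y)).
have -> : pN (mu (F x ⊗ F y)) = pN (mu (phi x ⊗ phi y))
    + t *: pN (mu (phi x ⊗ y)) + t *: pN (mu (x ⊗ phi y))
    + t *: (t *: pN (mu (x ⊗ y))).
  rewrite [F x]FE [F y]FE tpureDl !tpureDr !(tpureZl, tpureZr).
  by rewrite !linearD !linearZ /= !addrA.
move: (mu (F x ⊗ F y)) => m; rewrite !FE.
move: (pN (mu (phi x ⊗ phi y))) (pN (mu (phi x ⊗ y))).
move: (pN (mu (x ⊗ phi y))) (pN (mu (x ⊗ y))) => B2 C A B1.
rewrite !(linearD, linearN) !linearZ /=.
move: (phi C) (phi (phi C)) (phi B1) (phi B2) => pC ppC pB1 pB2.
(* After applying the injective [f t], the division is a polynomial identity with vector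
   coefficients, which [ring] checks coordinate by coordinate. *)
by apply: coord_eqP => i; rewrite !(linearD, linearN) !linearZ /=; ring.
Qed.

Let lim0_act_mul_regular :
  lim0 (fun t => (((f t)^-1 \o pR) \o (mu \o (f t ⊠ f t))) + t *: (pN \o mu)
    + regular)%VF (mul0 phi VR VN mu).
Proof.
have -> : mul0 phi VR VN mu =
    (((phiV \o pR) \o (mu \o (phi ⊠ phi))) + (0 : K) *: (pN \o mu) + regular)%VF.
  by rewrite /mul0 /regular scale0r addr0 !addrA !comp_lfunA.
apply: lim0D (lim0_cst _); apply: lim0D.
  apply: lim0_comp lim0_deform_inv_pR (lim0_comp (lim0_cst _) _).
  exact: lim0_tmap lim0_deform lim0_deform.
exact: lim0Z (rat_lim0_id K) (lim0_cst _).
Qed.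

Lemma lim0_act_mul : mul_condition phi VR VN mu ->
  lim0 (fun t => act_mul (f t) mu) (mul0 phi VR VN mu).
Proof.
move=> /mul_conditionE d0; apply: lim0_ext lim0_act_mul_regular.
apply: cofinitely_mono deform_invertible => t kf.
by rewrite (act_mul_split kf) d0 comp_lfun0r addr0.
Qed.

(** If f_t.mu converges, so does its difference with the regular part, which is [(f t)^-1] of the
    constant [defect]. *)
Lemma mul_condition_necessary mu0 :
  lim0 (fun t => act_mul (f t) mu) mu0 -> mul_condition phi VR VN mu.
Proof.
move=> lim_mu; apply/mul_conditionE/lfunP => T; rewrite zero_lfunE.
apply: (@deform_inv_lim0_eq0 _ (mu0 T - mul0 phi VR VN mu T) (defect_VN T)).
apply: lim0_ext (lim0B (lim0_app lim_mu (lim0_cst T))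
  (lim0_app lim0_act_mul_regular (lim0_cst T))).
apply: cofinitely_mono deform_invertible => t kf; rewrite (act_mul_split kf).
by rewrite [in LHS]add_lfunE comp_lfunE addrAC subrr add0r.
Qed.

End Multiplication.

(** * Condition (ii) and the limit of the comultiplication *)

Section Comultiplication.
Variable Delta : 'Hom(V, tens V V).

(** Taking [q = pR] gives the first line of (ii) up to sign, and [q = pN] gives the fourth. *)
Let defectr (q : 'End(V)) : 'Hom(V, tens V V) :=
  (((q ⊠ pN) \o (Delta \o phi)) - ((q ⊠ (phi \o pN)) \o Delta))%VF.

Let defectl (q : 'End(V)) : 'Hom(V, tens V V) :=
  (((pN ⊠ q) \o (Delta \o phi)) - (((phi \o pN) ⊠ q) \o Delta))%VF.

Let pN_phi_pN : (pN \o (phi \o pN))%VF = (phi \o pN)%VF.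
Proof. by apply/lfunP => v; rewrite !comp_lfunE -phi_pN -[pN (pN v)]comp_lfunE pN_pN. Qed.

Let defectr_pN q x : (\1 ⊠ pN)%VF (defectr q x) = defectr q x.
Proof.
rewrite -comp_lfunE /defectr comp_lfunDr comp_lfunNr !comp_lfunA !tmap_comp.
by rewrite !comp_lfun1l pN_pN pN_phi_pN.
Qed.

Let defectl_pN q x : (pN ⊠ \1)%VF (defectl q x) = defectl q x.
Proof.
rewrite -comp_lfunE /defectl comp_lfunDr comp_lfunNr !comp_lfunA !tmap_comp.
by rewrite !comp_lfun1l pN_pN pN_phi_pN.
Qed.

(** Expand the outer [f t] as [phi + t] and use [t *: ((f t)^-1 \o pN) = pN - (f t)^-1 \o phi \o pN]
    on the second factor. *)
Let splitr q t : lker (f t) == 0%VS ->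
  ((q ⊠ ((f t)^-1 \o pN)) \o Delta \o f t
   = ((q ⊠ pN) \o Delta) + ((\1 ⊠ (f t)^-1) \o defectr q))%VF.
Proof.
have : f t = phi + t *: \1%VF by []; move: (f t) => F FE kf.
rewrite /defectr {2}FE comp_lfunDr -comp_lfunZr comp_lfun1r.
rewrite comp_lfunDr comp_lfunNr !comp_lfunA !tmap_comp !comp_lfun1l.
rewrite -!comp_lfunA [RHS]addrCA; congr (_ + _).
rewrite comp_lfunZl -tmapZr.
have -> : t *: (F^-1 \o pN)%VF = (pN - (F^-1 \o (phi \o pN)))%VF.
  rewrite -[X in X - _](lker0_compKf kf) {3}FE comp_lfunDl comp_lfunDr.
  by rewrite addrAC subrr add0r -comp_lfunZl comp_lfun1l comp_lfunZr.
by rewrite tmapDr -scaleN1r tmapZr scaleN1r comp_lfunDl comp_lfunNl.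
Qed.

Let splitl q t : lker (f t) == 0%VS ->
  ((((f t)^-1 \o pN) ⊠ q) \o Delta \o f t
   = ((pN ⊠ q) \o Delta) + (((f t)^-1 ⊠ \1) \o defectl q))%VF.
Proof.
have : f t = phi + t *: \1%VF by []; move: (f t) => F FE kf.
rewrite /defectl {2}FE comp_lfunDr -comp_lfunZr comp_lfun1r.
rewrite comp_lfunDr comp_lfunNr !comp_lfunA !tmap_comp !comp_lfun1l.
rewrite -!comp_lfunA [RHS]addrCA; congr (_ + _).
rewrite comp_lfunZl -tmapZl.
have -> : t *: (F^-1 \o pN)%VF = (pN - (F^-1 \o (phi \o pN)))%VF.
  rewrite -[X in X - _](lker0_compKf kf) {3}FE comp_lfunDl comp_lfunDr.
  by rewrite addrAC subrr add0r -comp_lfunZl comp_lfun1l comp_lfunZr.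
by rewrite tmapDl -scaleN1r tmapZl scaleN1r comp_lfunDl comp_lfunNl.
Qed.

Lemma comul_condition_necessary Delta0 :
  lim0 (fun t => act_comul (f t) Delta) Delta0 ->
  comul_condition phi VR VN Delta.
Proof.
move=> lim_D.
(* Composing f_t.Delta with [(q \o f t) ⊠ pN] cancels the inverse on the first factor and keeps
   convergence, which yields the left side of [splitr]. *)
have limr q : (forall t, f t \o q = q \o f t)%VF ->
    lim0 (fun t => (q ⊠ ((f t)^-1 \o pN)) \o Delta \o f t)%VF
      (((q \o phi) ⊠ pN) \o Delta0)%VF.
  move=> fq; apply: lim0_ext (lim0_comp (lim0_tmap
    (lim0_comp (lim0_cst q) lim0_deform) (lim0_cst pN)) lim_D).
  apply: cofinitely_mono deform_invertible => t kf.
  rewrite /act_comul !comp_lfunA tmap_comp -(comp_lfunA q) lker0_compfV // comp_lfun1r.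
  by rewrite (inv_lfun_comm kf) // deform_pN.
have liml q : (forall t, f t \o q = q \o f t)%VF ->
    lim0 (fun t => (((f t)^-1 \o pN) ⊠ q) \o Delta \o f t)%VF
      ((pN ⊠ (q \o phi)) \o Delta0)%VF.
  move=> fq; apply: lim0_ext (lim0_comp (lim0_tmap (lim0_cst pN)
    (lim0_comp (lim0_cst q) lim0_deform)) lim_D).
  apply: cofinitely_mono deform_invertible => t kf.
  rewrite /act_comul !comp_lfunA tmap_comp -(comp_lfunA q) lker0_compfV // comp_lfun1r.
  by rewrite (inv_lfun_comm kf) // deform_pN.
have dr q : (forall t, f t \o q = q \o f t)%VF -> defectr q = 0.
  move=> fq; apply/lfunP => x; rewrite zero_lfunE.
  apply: (@tmapr_deform_inv_lim0_eq0 _ _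
    (((((q \o phi) ⊠ pN) \o Delta0) - ((q ⊠ pN) \o Delta))%VF x) (defectr_pN q x)).
  apply: lim0_ext (lim0_app (lim0B (limr q fq) (lim0_cst _)) (lim0_cst x)).
  apply: cofinitely_mono deform_invertible => t kf.
  by rewrite splitr // addrC addKr comp_lfunE.
have dl q : (forall t, f t \o q = q \o f t)%VF -> defectl q = 0.
  move=> fq; apply/lfunP => x; rewrite zero_lfunE.
  apply: (@tmapl_deform_inv_lim0_eq0 _ _
    ((((pN ⊠ (q \o phi)) \o Delta0) - ((pN ⊠ q) \o Delta))%VF x) (defectl_pN q x)).
  apply: lim0_ext (lim0_app (lim0B (liml q fq) (lim0_cst _)) (lim0_cst x)).
  apply: cofinitely_mono deform_invertible => t kf.
  by rewrite splitl // addrC addKr comp_lfunE.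
have drE q x : (q ⊠ pN)%VF (Delta (phi x)) - (q ⊠ (phi \o pN)%VF) (Delta x)
    = defectr q x.
  by rewrite /defectr add_lfunE opp_lfunE !comp_lfunE.
have dlE q x : (pN ⊠ q)%VF (Delta (phi x)) - ((phi \o pN)%VF ⊠ q) (Delta x)
    = defectl q x.
  by rewrite /defectl add_lfunE opp_lfunE !comp_lfunE.
move=> x; split.
- by rewrite -opprB drE dr ?zero_lfunE ?oppr0 //; apply: deform_pR.
- by rewrite -opprB dlE dl ?zero_lfunE ?oppr0 //; apply: deform_pR.
(* Since [defectr pN = 0], the [VN ⊗ VN] component of f_t.Delta is [(f t)^-1 ⊠ \1] applied to the
   constant component of [Delta]. *)
- apply: (@tmapl_deform_inv_lim0_eq0 _ _ (((pN ⊠ pN) \o Delta0)%VF x)).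
    by rewrite -comp_lfunE tmap_comp comp_lfun1l pN_pN.
  apply: lim0_ext (lim0_app (lim0_comp (lim0_cst (pN ⊠ pN)) lim_D) (lim0_cst x)).
  apply: cofinitely_mono deform_invertible => t kf.
  have := splitr pN kf; rewrite dr; last exact: deform_pN.
  rewrite comp_lfun0r addr0 => /lfunP/(_ x); rewrite comp_lfunE [RHS]comp_lfunE => <-.
  rewrite -!comp_lfunE /act_comul !comp_lfunA !tmap_comp comp_lfun1l.
  by rewrite -!(inv_lfun_comm kf) // deform_pN.
- by rewrite drE dr ?zero_lfunE //; apply: deform_pN.
Qed.

(** Split both inverses along [pR + pN]. The [VR ⊗ VR] block converges, each mixed block loses its
    inverse on [VN] because its defect is 0, and the [VN ⊗ VN] block vanishes by the last two lines
    of (ii). *)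
Lemma lim0_act_comul : comul_condition phi VR VN Delta ->
  lim0 (fun t => act_comul (f t) Delta) (comul0 phi VR VN Delta).
Proof.
move=> cond.
have dr : defectr pR = 0.
  apply/lfunP => x; rewrite /defectr add_lfunE opp_lfunE !comp_lfunE zero_lfunE.
  by have [/eqP] := cond x; rewrite subr_eq0 => /eqP <-; rewrite subrr.
have dl : defectl pR = 0.
  apply/lfunP => x; rewrite /defectl add_lfunE opp_lfunE !comp_lfunE zero_lfunE.
  by have [_ /eqP] := cond x; rewrite subr_eq0 => /eqP <-; rewrite subrr.
have nn : ((pN ⊠ pN) \o Delta = 0)%VF.
  by apply/lfunP => x; rewrite comp_lfunE zero_lfunE; have [] := cond x.
have dn : defectr pN = 0.
  apply/lfunP => x; rewrite /defectr add_lfunE opp_lfunE !comp_lfunE zero_lfunE.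
  by have [] := cond x.
rewrite /comul0.
apply: (@lim0_ext _ _ (fun t =>
   ((((f t)^-1 \o pR) ⊠ ((f t)^-1 \o pR)) \o Delta \o f t)
   + ((((f t)^-1 \o pR) ⊠ pN) \o Delta)
   + ((pN ⊠ ((f t)^-1 \o pR)) \o Delta))%VF); last first.
  have iR := lim0_deform_inv_pR; have cD := lim0_cst Delta; have cN := lim0_cst pN.
  apply: lim0D (lim0_comp (lim0_tmap cN iR) cD).
  apply: lim0D (lim0_comp (lim0_tmap iR cN) cD).
  exact: lim0_comp (lim0_comp (lim0_tmap iR iR) cD) lim0_deform.
apply: cofinitely_mono deform_invertible => t kf.
have iD : ((f t)^-1 = ((f t)^-1 \o pR) + ((f t)^-1 \o pN))%VF.
  by rewrite -comp_lfunDr fitting_projD comp_lfun1r.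
rewrite /act_comul {5 6}iD tmapDl !tmapDr !comp_lfunDl -!addrA; congr (_ + _).
have sr := splitr pR kf; have sl := splitl pR kf; have sn := splitr pN kf.
rewrite dr comp_lfun0r addr0 in sr; rewrite dl comp_lfun0r addr0 in sl.
rewrite dn nn comp_lfun0r addr0 in sn.
(* One inverse is factored out of each block so that [sr], [sl] and [sn] apply to the rest. *)
have -> : ((f t)^-1 \o pR) ⊠ ((f t)^-1 \o pN) =
    (((f t)^-1 ⊠ \1) \o (pR ⊠ ((f t)^-1 \o pN)))%VF.
  by rewrite tmap_comp comp_lfun1l.
have -> : ((f t)^-1 \o pN) ⊠ ((f t)^-1 \o pR) =
    ((\1 ⊠ (f t)^-1) \o (((f t)^-1 \o pN) ⊠ pR))%VF.
  by rewrite tmap_comp comp_lfun1l.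
have -> : ((f t)^-1 \o pN) ⊠ ((f t)^-1 \o pN) =
    (((f t)^-1 ⊠ \1) \o (pN ⊠ ((f t)^-1 \o pN)))%VF.
  by rewrite tmap_comp comp_lfun1l.
rewrite -!comp_lfunA !(comp_lfunA _ Delta) sr sl sn comp_lfun0r addr0.
by rewrite !comp_lfunA !tmap_comp !comp_lfun1l.
Qed.

End Comultiplication.
End Resolvent.

(** * Transport of structure along an invertible map *)

Section Transport.
Variables (K : fieldType) (V : vectType K).
Variables (mu : 'Hom(tens V V, V)) (Delta : 'Hom(V, tens V V)).
Variables (f : 'End(V)) (kf : lker f == 0%VS).

(** The convolution product, with explicit structure maps so that it serves H, f_t.H and the limit
    alike. *)
Definition conv (m : 'Hom(tens V V, V)) (D : 'Hom(V, tens V V)) (a b : 'End(V)) :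
  'End(V) := (m \o (a ⊠ b) \o D)%VF.

(** Conjugation by [f], here [act_antipode] of any endomorphism, is multiplicative for convolution
    because the inner copies of [f] and [f^-1] cancel. *)
Lemma act_conv a b :
  conv (act_mul f mu) (act_comul f Delta) (act_antipode f a) (act_antipode f b)
  = act_antipode f (conv mu Delta a b).
Proof.
have key : ((f ⊠ f) \o (act_antipode f a ⊠ act_antipode f b) \o (f^-1 ⊠ f^-1)
    = a ⊠ b)%VF.
  rewrite /act_antipode !tmap_comp !comp_lfunA lker0_compfV // !comp_lfun1l.
  by rewrite !lker0_compfK.
apply/lfunP => v; rewrite /conv -key /act_mul /act_comul {2}/act_antipode.
by rewrite !comp_lfunE.
Qed.

Lemma act_id : act_antipode f \1%VF = \1%VF.
Proof. by rewrite /act_antipode comp_lfun1r lker0_compVf. Qed.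

Lemma act_unit_counit (eta : 'Hom(K^o, V)) (eps : 'Hom(V, K^o)) :
  act_antipode f (eta \o eps)%VF = (act_unit f eta \o act_counit f eps)%VF.
Proof. by rewrite /act_antipode /act_unit /act_counit !comp_lfunA. Qed.

Lemma act_comulM :
  ((mu ⊠ mu) \o tmid V \o (Delta ⊠ Delta) = Delta \o mu)%VF ->
  ((act_mul f mu ⊠ act_mul f mu) \o tmid V
     \o (act_comul f Delta ⊠ act_comul f Delta)
   = act_comul f Delta \o act_mul f mu)%VF.
Proof.
move=> comulM.
have key : (((f ⊠ f) ⊠ (f ⊠ f)) \o tmid V \o ((f^-1 ⊠ f^-1) ⊠ (f^-1 ⊠ f^-1))
    = tmid V)%VF.
  rewrite tmid_natural -comp_lfunA !tmap_comp lker0_compfV //.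
  by rewrite !tmap1 comp_lfun1r.
rewrite /act_mul /act_comul -!tmap_comp.
transitivity ((f^-1 ⊠ f^-1) \o (Delta \o mu) \o (f ⊠ f))%VF.
  by rewrite -comulM -[in RHS]key; apply/lfunP => v; rewrite !comp_lfunE.
by apply/lfunP => v; rewrite !comp_lfunE lker0_lfunVK.
Qed.

End Transport.

(** * The antipode as a convolution polynomial in the identity *)

Section Antipode.
Variables (K : fieldType) (V : vectType K).

Lemma mem_span_iter (W : vectType K) (L : 'End(W)) (s : seq W) w i :
  lker L == 0%VS ->
  iter i L w \in <<map (iter i L) s>>%VS -> w \in <<s>>%VS.
Proof.
move=> kL; elim: i => [|i IH]; first by rewrite map_id.
have -> : map (iter i.+1 L) s = map L (map (iter i L) s).
  by rewrite -map_comp; apply: eq_map.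
rewrite iterS -limg_span => /memv_imgP[u us e].
by apply: IH; rewrite (lker0P kL _ _ e).
Qed.

(* The first dependency among the iterates of w, cancelled through L.          *)
Lemma krylov (W : vectType K) (L : 'End(W)) (w : W) : lker L == 0%VS ->
  exists N (c : 'I_N -> K), w = \sum_(k < N) c k *: iter k L (L w).
Proof.
move=> kL; pose n := \dim {:W}; pose X := [tuple iter i L w | i < n.+1].
have : ~~ free X.
  rewrite /free size_tuple neq_ltn ltnS (leq_trans (dimvS (subvf _))) //.
(* There are [n.+1] iterates in dimension [n], so some [iter i L w] lies in the span of the later
   ones; injectivity of [L] then removes the common power [i]. *)
rewrite freeNE => /existsP[i].
pose s := [tuple iter k L (L w) | k < n.+1].
rewrite -tnth_nth tnth_mktuple => wi.
have /(mem_span_iter kL) ws : iter i L w \in <<map (iter i L) s>>%VS.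
  apply: subvP wi; apply: sub_span => x /(nthP 0)[j].
  rewrite size_drop size_tuple nth_drop => jlt <-.
  have ij : (i.+1 + j < n.+1)%N by rewrite -ltn_subRL.
  have jn : (j < n.+1)%N by apply: leq_ltn_trans ij; rewrite leq_addl.
  rewrite -[(i.+1 + j)%N]/(val (Ordinal ij)) -tnth_nth tnth_mktuple /=.
  apply/mapP; exists (iter j L (L w)).
    by apply/mapP; exists (Ordinal jn) => //; rewrite mem_enum.
  by rewrite -iterD -iterSr.
exists n.+1, (fun k => coord s k w); rewrite {1}(coord_span ws).
by apply: eq_bigr => k _; rewrite -tnth_nth tnth_mktuple.
Qed.

Variables (mu : 'Hom(tens V V, V)) (eta : 'Hom(K^o, V)).
Variables (Delta : 'Hom(V, tens V V)) (eps : 'Hom(V, K^o)) (S : 'End(V)).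
Hypothesis hopfH : is_hopf mu eta Delta eps S.

Lemma convA a b c :
  conv mu Delta (conv mu Delta a b) c = conv mu Delta a (conv mu Delta b c).
Proof.
have muA : (mu \o (mu ⊠ \1) \o ((a ⊠ b) ⊠ c)
    = mu \o (\1 ⊠ mu) \o (a ⊠ (b ⊠ c)) \o tassoc V)%VF.
  apply: tens3P => x y z; rewrite !comp_lfunE tassocE !tmapE !id_lfunE.
  exact: hopf_mulA hopfH _ _ _.
have splitl : (mu \o (a ⊠ b) \o Delta)%VF ⊠ c
    = ((mu ⊠ \1) \o ((a ⊠ b) ⊠ c) \o (Delta ⊠ \1))%VF.
  by rewrite !tmap_comp comp_lfun1l comp_lfun1r.
have splitr : a ⊠ (mu \o (b ⊠ c) \o Delta)%VF
    = ((\1 ⊠ mu) \o (a ⊠ (b ⊠ c)) \o (\1 ⊠ Delta))%VF.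
  by rewrite !tmap_comp comp_lfun1l comp_lfun1r.
rewrite /conv splitl splitr !comp_lfunA muA.
by rewrite -!(comp_lfunA _ _ Delta) -(hopf_coassoc hopfH) !comp_lfunA.
Qed.

Lemma conv_unitl a : conv mu Delta (eta \o eps)%VF a = a.
Proof.
apply/lfunP => v; rewrite /conv comp_lfunE.
have -> : (mu \o ((eta \o eps) ⊠ a))%VF = (a \o tlift (fun v w => eps v *: w))%VF.
  apply: tensP => x y; rewrite !comp_lfunE tmapE tliftE; last 2 first.
  - by move=> w k u u'; rewrite linearP scalerDl scalerA.
  - by move=> u k w w'; rewrite scalerDr !scalerA mulrC.
  rewrite comp_lfunE -[eps x in LHS]mulr1 -[eps x * 1]/(eps x *: (1 : K^o)) linearZ /=.
  by rewrite tpureZl linearZ /= (hopf_mul1l hopfH) linearZ.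
by rewrite comp_lfunE (hopf_counitl hopfH).
Qed.

Lemma conv_linear (m : 'Hom(tens V V, V)) (D : 'Hom(V, tens V V)) a :
  linear (conv m D a).
Proof.
move=> k b c; rewrite /conv tmap_linearr comp_lfunDr comp_lfunDl.
by rewrite -comp_lfunZr -comp_lfunZl.
Qed.

(** Convolution by the identity on the left is injective, with left inverse convolution by [S], and
    it sends [S] to the convolution unit [eta \o eps]. So [krylov] applies with [w = S]. *)
Lemma antipode_polynomial : exists N (c : 'I_N -> K),
  S = \sum_(k < N) c k *: iter k (conv mu Delta \1%VF) (eta \o eps)%VF.
Proof.
pose lin : {linear 'End(V) -> 'End(V)} := HB.pack (conv mu Delta \1%VF)
  (GRing.isLinear.Build _ _ _ _ _ (conv_linear mu Delta \1%VF)).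
have LE : linfun lin =1 conv mu Delta \1%VF by exact: lfunE.
have kL : lker (linfun lin) == 0%VS.
  apply/lker0P => a b; rewrite !LE => /(congr1 (conv mu Delta S)).
  rewrite -!convA; have -> : conv mu Delta S \1%VF = (eta \o eps)%VF.
    exact: hopf_antipodel hopfH.
  by rewrite !conv_unitl.
have [N [c SE]] := krylov S kL; exists N, c; rewrite {1}SE.
apply: eq_bigr => k _; rewrite LE (eq_iter LE); congr (_ *: iter k _ _).
exact: hopf_antipoder hopfH.
Qed.

End Antipode.

(** * Passage of the Hopf identities to the limit *)

Section AntipodeLimit.
Variables (K : closedFieldType) (V : vectType K).

Lemma lim0_conv (m : K -> 'Hom(tens V V, V)) (D : K -> 'Hom(V, tens V V))
    (a b : K -> 'End(V)) m0 D0 a0 b0 :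
  lim0 m m0 -> lim0 D D0 -> lim0 a a0 -> lim0 b b0 ->
  lim0 (fun t => conv (m t) (D t) (a t) (b t)) (conv m0 D0 a0 b0).
Proof.
by move=> lm lD la lb; apply: lim0_comp (lim0_comp lm (lim0_tmap la lb)) lD.
Qed.

Lemma lim0_iter_conv (m : K -> 'Hom(tens V V, V)) (D : K -> 'Hom(V, tens V V))
    (e : K -> 'End(V)) m0 D0 e0 k :
  lim0 m m0 -> lim0 D D0 -> lim0 e e0 ->
  lim0 (fun t => iter k (conv (m t) (D t) \1%VF) (e t))
       (iter k (conv m0 D0 \1%VF) e0).
Proof.
move=> lm lD le; elim: k => //= k IH.
exact: lim0_conv lm lD (lim0_cst _) IH.
Qed.

Lemma act_antipode_linear (f : 'End(V)) : linear (act_antipode f).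
Proof.
move=> k a b; rewrite /act_antipode comp_lfunDr comp_lfunDl.
by rewrite -comp_lfunZr -comp_lfunZl.
Qed.

Variables (mu : 'Hom(tens V V, V)) (eta : 'Hom(K^o, V)).
Variables (Delta : 'Hom(V, tens V V)) (eps : 'Hom(V, K^o)) (S : 'End(V)).
Hypothesis hopfH : is_hopf mu eta Delta eps S.
Variables (f : K -> 'End(V)).
Hypothesis f_inv : cofinitely (fun t => lker (f t) == 0%VS).
Variables (mu0 : 'Hom(tens V V, V)) (eta0 : 'Hom(K^o, V)).
Variables (Delta0 : 'Hom(V, tens V V)) (eps0 : 'Hom(V, K^o)).
Hypothesis lim_mu : lim0 (fun t => act_mul (f t) mu) mu0.
Hypothesis lim_Delta : lim0 (fun t => act_comul (f t) Delta) Delta0.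
Hypothesis lim_eta : lim0 (fun t => act_unit (f t) eta) eta0.
Hypothesis lim_eps : lim0 (fun t => act_counit (f t) eps) eps0.

Lemma limit_comulM :
  ((mu0 ⊠ mu0) \o tmid V \o (Delta0 ⊠ Delta0))%VF = (Delta0 \o mu0)%VF.
Proof.
apply: lim0_unique (lim0_comp lim_Delta lim_mu).
apply: lim0_ext (lim0_comp (lim0_comp (lim0_tmap lim_mu lim_mu)
  (lim0_cst (tmid V))) (lim0_tmap lim_Delta lim_Delta)).
apply: cofinitely_mono f_inv => t kf.
exact: act_comulM kf (hopf_comulM hopfH).
Qed.

(** Conjugation by [f t] carries the convolution powers of the identity in H to those in f_t.H,
    which converge; the coefficients [c] are the same for every [t]. *)
Lemma lim0_antipode : exists S0, lim0 (fun t => act_antipode (f t) S) S0.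
Proof.
have [N [c SE]] := antipode_polynomial hopfH.
exists (\sum_(k < N) c k *: iter k (conv mu0 Delta0 \1%VF) (eta0 \o eps0)%VF).
apply: (@lim0_ext _ _ (fun t => \sum_(k < N) c k *:
  iter k (conv (act_mul (f t) mu) (act_comul (f t) Delta) \1%VF)
    (act_unit (f t) eta \o act_counit (f t) eps)%VF)); last first.
  apply: lim0_sum => k _; apply: lim0Z (rat_lim0_cst _) _.
  exact: lim0_iter_conv lim_mu lim_Delta (lim0_comp lim_eta lim_eps).
apply: cofinitely_mono f_inv => t kf.
pose lin : {linear 'End(V) -> 'End(V)} := HB.pack (act_antipode (f t))
  (GRing.isLinear.Build _ _ _ _ _ (act_antipode_linear (f t))).
rewrite -[RHS]/(lin S) [in RHS]SE linear_sum; apply: eq_bigr => k _.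
rewrite linearZ; congr (_ *: _); rewrite /= -act_unit_counit.
elim: {c SE}(k : nat) => //= j ->.
by rewrite -[X in conv _ _ X _](act_id kf) act_conv.
Qed.

Lemma limit_antipode S0 : lim0 (fun t => act_antipode (f t) S) S0 ->
  (mu0 \o (S0 ⊠ \1) \o Delta0)%VF = (eta0 \o eps0)%VF /\
  (mu0 \o (\1 ⊠ S0) \o Delta0)%VF = (eta0 \o eps0)%VF.
Proof.
move=> lim_S; have lim1 := lim0_cst (\1%VF : 'End(V)).
split; apply: lim0_unique (lim0_comp lim_eta lim_eps).
  apply: lim0_ext (lim0_conv lim_mu lim_Delta lim_S lim1).
  apply: cofinitely_mono f_inv => t kf; rewrite -(act_id kf) act_conv //.
  by rewrite -act_unit_counit -(hopf_antipodel hopfH).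
apply: lim0_ext (lim0_conv lim_mu lim_Delta lim1 lim_S).
apply: cofinitely_mono f_inv => t kf; rewrite -(act_id kf) act_conv //.
by rewrite -act_unit_counit -(hopf_antipoder hopfH).
Qed.

End AntipodeLimit.

Theorem mainTheorem9 (K : closedFieldType) (charK : [pchar K] =i pred0)
    (V : vectType K)
    (mu : 'Hom(tens V V, V)) (eta : 'Hom(K^o, V))
    (Delta : 'Hom(V, tens V V)) (eps : 'Hom(V, K^o)) (S : 'End(V))
    (hopfH : is_hopf mu eta Delta eps S)
    (phi : 'End(V)) (phi_singular : lker phi != 0%VS)
    (VR VN : {vspace V}) (fitting_phi : is_fitting phi VR VN) :
  let f := deform phi in
  let mu0 := mul0 phi VR VN mu in
  let Delta0 := comul0 phi VR VN Delta in
  (degeneration_exists f mu Delta <->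
     mul_condition phi VR VN mu /\ comul_condition phi VR VN Delta) /\
  (degeneration_exists f mu Delta ->
     [/\ lim0 (fun t => act_mul (f t) mu) mu0,
         lim0 (fun t => act_comul (f t) Delta) Delta0,
         ((mu0 ⊠ mu0) \o tmid V \o (Delta0 ⊠ Delta0))%VF = (Delta0 \o mu0)%VF
       & exists (eta0 : 'Hom(K^o, V)) (eps0 : 'Hom(V, K^o)) (S0 : 'End(V)),
         [/\ lim0 (fun t => act_unit (f t) eta) eta0,
             lim0 (fun t => act_counit (f t) eps) eps0,
             lim0 (fun t => act_antipode (f t) S) S0,
             (mu0 \o (S0 ⊠ \1) \o Delta0)%VF = (eta0 \o eps0)%VF
           & (mu0 \o (\1 ⊠ S0) \o Delta0)%VF = (eta0 \o eps0)%VF]]).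
Proof.
move=> f mu0 Delta0.
have existsP : degeneration_exists f mu Delta <->
    mul_condition phi VR VN mu /\ comul_condition phi VR VN Delta.
  split=> [[[m lm] [D lD]]|[cm cD]].
    split; first exact (mul_condition_necessary fitting_phi lm).
    exact (comul_condition_necessary fitting_phi lD).
  split; first by exists mu0; apply: lim0_act_mul.
  by exists Delta0; apply: lim0_act_comul.
split=> // /existsP[cm cD].
have lim_mu : lim0 (fun t => act_mul (f t) mu) mu0 by apply: lim0_act_mul.
have lim_Delta : lim0 (fun t => act_comul (f t) Delta) Delta0.
  exact: lim0_act_comul.
have f_inv : cofinitely (fun t => lker (f t) == 0%VS).
  exact: deform_invertible fitting_phi.
(* The third comultiplication condition at 1 reads 1_N ⊗ 1_N = 0.              *)
have unit_VR : (daddv_pi VR VN \o eta)%VF = eta.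
  apply/lfunP => k; rewrite comp_lfunE -[k]mulr1 -[k * 1]/(k *: (1 : K^o)).
  rewrite !linearZ; congr (k *: _).
  have [_ _ + _] := cD (eta 1); rewrite (hopf_comul1 hopfH) tmapE.
  move=> /tpure_sqr_eq0 N1.
  by have := fitting_split fitting_phi (eta 1); rewrite N1 addr0.
(* As the unit lies in [VR], only the convergent part of [(f t)^-1] acts on it. *)
have lim_eta : lim0 (fun t => act_unit (f t) eta)
    ((fitting_inv phi VR VN \o daddv_pi VR VN) \o eta)%VF.
  apply: lim0_ext (lim0_comp (lim0_deform_inv_pR fitting_phi) (lim0_cst eta)).
  by apply: cofinitely_all => t; rewrite /act_unit -comp_lfunA unit_VR.
have lim_eps : lim0 (fun t => act_counit (f t) eps) (eps \o phi)%VF.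
  exact: lim0_comp (lim0_cst eps) (lim0_deform phi).
have [S0 lim_S] := lim0_antipode hopfH f_inv lim_mu lim_Delta lim_eta lim_eps.
split=> //; first exact (limit_comulM hopfH f_inv lim_mu lim_Delta).
exists ((fitting_inv phi VR VN \o daddv_pi VR VN) \o eta)%VF, (eps \o phi)%VF, S0.
by have [] := limit_antipode hopfH f_inv lim_mu lim_Delta lim_eta lim_eps lim_S.
Qed.
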